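(* Let $S$ be an ordered semigroup without zero element. Then $S$ is a Clifford ordered semigroup if and only if it is a complete semilattice of group like ordered semigroups.
   Context: An ordered semigroup $(S,\cdot,\le)$ is a semigroup $(S,\cdot)$ that is a poset $(S,\le)$ such that $a\le b$ implies $ca\le cb$ and $ac\le bc$ for all $a,b,c\in S$. A zero element is an element $0$ with $0x=x0=0$ and $0\le x$ for all $x\in S$. For $H\subseteq S$, $(H]=\{t\in S: t\le h \text{ for some } h\in H\}$. $S$ is regular if $a\in(aSa]$ for every $a\in S$. The set of ordered idempotents is $E_{\le}(S)=\{e\in S: e\le e^2\}$. A Clifford ordered semigroup is a regular ordered semigroup $S$ such that for all $a\in S$ and $e\in E_{\le}(S)$ there are $u,v\in S$ with $ae\le eua$ and $ea\le ave$. An ordered semigroup $T$ (equivalently, a $t$-simple one) is group like if for all $a,b\in T$ there are $x,y\in T$ such that $a\le xb$ and $a\le by$. A congruence on $S$ is an equivalence relation $\rho$ such that $a\,\rho\,b$ implies $ca\,\rho\,cb$ and $ac\,\rho\,bc$ for all $c\in S$. It is a semilattice congruence if $a\,\rho\,a^2$ and $ab\,\rho\,ba$ for all $a,b\in S$, and a complete semilattice congruence if moreover $a\le b$ implies $a\,\rho\,ab$. $S$ is a complete semilattice of (sub)semigroups of type $\tau$ if there is a complete semilattice congruence $\rho$ on $S$ such that every $\rho$-class is a subsemigroup of $S$ of type $\tau$ (with the induced order). *)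

(* Defs.v *)
(* Built on the Rocq standard library. *)
From Stdlib Require Import Relation_Definitions ProofIrrelevance.

Set Implicit Arguments.
Unset Strict Implicit.

Declare Scope osg_scope.
Delimit Scope osg_scope with osg.

Record ordered_semigroup : Type := OrderedSemigroup {
  carrier :> Type;
  op : carrier -> carrier -> carrier;
  le : relation carrier;
  op_assoc : forall a b c, op a (op b c) = op (op a b) c;
  le_order : order carrier le;
  le_opl : forall a b c, le a b -> le (op c a) (op c b);
  le_opr : forall a b c, le a b -> le (op a c) (op b c)
}.

Notation "a * b" := (op a b) : osg_scope.
Notation "a <= b" := (le a b) : osg_scope.
Open Scope osg_scope.

Section Notions.
Variable S : ordered_semigroup.
Implicit Types (a b c e t u v x y z : S) (H : S -> Prop) (rho : relation S).

Definition is_zero z : Prop :=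
  forall x, z * x = z /\ x * z = z /\ z <= x.

Definition has_zero : Prop := exists z, is_zero z.

(* The downward closure (H]. *)
Definition downset H t : Prop := exists h, H h /\ t <= h.

Definition regular : Prop :=
  forall a, downset (fun t => exists x, t = a * x * a) a.

Definition ordered_idempotent e : Prop := e <= e * e.

Definition clifford : Prop :=
  regular /\
  forall a e, ordered_idempotent e ->
    exists u v, a * e <= e * u * a /\ e * a <= a * v * e.

Definition group_like : Prop :=
  forall a b, exists x y, a <= x * b /\ a <= b * y.

Definition congruence rho : Prop :=
  equivalence S rho /\
  forall a b c, rho a b -> rho (c * a) (c * b) /\ rho (a * c) (b * c).

Definition semilattice_congruence rho : Prop :=
  congruence rho /\
  (forall a, rho a (a * a)) /\
  (forall a b, rho (a * b) (b * a)).

Definition complete_semilattice_congruence rho : Prop :=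
  semilattice_congruence rho /\
  (forall a b, a <= b -> rho a (a * b)).

Definition subsemigroup H : Prop :=
  forall a b, H a -> H b -> H (a * b).

Section Induced.
Variables (H : S -> Prop) (HH : subsemigroup H).

Definition sub_op (a b : sig H) : sig H :=
  exist H (proj1_sig a * proj1_sig b) (HH (proj2_sig a) (proj2_sig b)).

Definition sub_le (a b : sig H) : Prop := proj1_sig a <= proj1_sig b.

Lemma sub_op_assoc (a b c : sig H) : sub_op a (sub_op b c) = sub_op (sub_op a b) c.
Proof. apply subset_eq_compat; apply op_assoc. Qed.

Lemma sub_le_order : order (sig H) sub_le.
Proof.
destruct (le_order S) as [Hrefl Htrans Hanti]; split.
- intros a; apply Hrefl.
- intros a b c; apply Htrans.
- intros [a Ha] [b Hb] Hab Hba.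
  apply subset_eq_compat; exact (Hanti a b Hab Hba).
Qed.

Lemma sub_le_opl (a b c : sig H) : sub_le a b -> sub_le (sub_op c a) (sub_op c b).
Proof. apply le_opl. Qed.

Lemma sub_le_opr (a b c : sig H) : sub_le a b -> sub_le (sub_op a c) (sub_op b c).
Proof. apply le_opr. Qed.

Definition induced : ordered_semigroup :=
  OrderedSemigroup sub_op_assoc sub_le_order sub_le_opl sub_le_opr.

End Induced.

(* The rho-class of c is the predicate [rho c]. *)
Definition complete_semilattice_of (tau : ordered_semigroup -> Prop) : Prop :=
  exists rho, complete_semilattice_congruence rho /\
    forall c, exists Hc : subsemigroup (rho c), tau (induced Hc).

End Notions.

(* Main.v *)
Require Import Defs.
From Stdlib Require Import Relation_Definitions.

Set Implicit Arguments.
Unset Strict Implicit.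

(** Write [below a b] for [a] lying in (bSb].  Everything rests on this relation.

    In a Clifford ordered semigroup, regularity [b <= b * x * b] makes [b * x] and
    [x * b] ordered idempotents, and moving them across a factor turns the Clifford
    condition, which speaks of ordered idempotents only, into the commutation law
    [a * b <= b * w * a] for arbitrary [a] and [b] ([clifford_swap]).  With this law
    one-sided and two-sided divisibility coincide: (SbS] is contained in (bSb]
    ([below_of_middle]).  Hence [below] is a preorder compatible with the product for
    which [a], [a * a] are equivalent and [a * b], [b * a] are equivalent; its
    symmetric part is the required complete semilattice congruence.  Its classes are
    group like: if [a <= b * z * b] with [a] and [b] equivalent, then [b * z] and
    [z * b] are squeezed into the class of [b], and they solve [a <= x * b] and
    [a <= b * y].

    Conversely, in a group like ordered semigroup any two elements satisfy
    [a <= b * z * b] ([group_like_below]).  If the classes of a semilattice congruence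
    are group like, applying this to the pair [a], [a] gives regularity, and applying
    it to the equivalent elements [a * e] and [e * a] gives the Clifford condition. *)

Section Order.
Variable S : ordered_semigroup.
Implicit Types a b c d : S.

Lemma le_refl a : a <= a.
Proof. apply (ord_refl _ _ (le_order S)). Qed.

Lemma le_trans a b c : a <= b -> b <= c -> a <= c.
Proof. apply (ord_trans _ _ (le_order S)). Qed.

Lemma op_mono a b c d : a <= b -> c <= d -> a * c <= b * d.
Proof.
intros Hab Hcd; apply le_trans with (b * c).
- now apply le_opr.
- now apply le_opl.
Qed.

Definition below a b : Prop := exists z, a <= b * z * b.

Lemma regular_below : regular S <-> forall a, below a a.
Proof.
split.
- intros HS a; destruct (HS a) as (h & (x & ->) & Hx); now exists x.
- intros HS a; destruct (HS a) as (x & Hx); exists (a * x * a); split; eauto.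
Qed.

Lemma below_trans a b c : below a b -> below b c -> below a c.
Proof.
intros [x Hx] [y Hy]; exists (y * c * x * c * y).
apply le_trans with (1 := Hx).
apply le_trans with ((c * y * c) * x * (c * y * c)).
- now apply op_mono; [apply le_opr|].
- rewrite !op_assoc; apply le_refl.
Qed.

Lemma le_below_trans a b c : a <= b -> below b c -> below a c.
Proof. intros Hab [z Hz]; exists z; now apply le_trans with b. Qed.

End Order.

Section CliffordToSemilattice.
Variable S : ordered_semigroup.
Hypothesis cliffS : clifford S.
Implicit Types a b c d s t : S.

Lemma below_refl a : below a a.
Proof. now apply regular_below; destruct cliffS. Qed.

(** Regularity of [b] gives [a * b <= a * (b * x) * b] with [b * x] an ordered
    idempotent, and the Clifford condition carries [b * x] to the left of [a]. *)
Lemma clifford_swap_left a b : exists w, a * b <= b * w * a * b.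
Proof.
destruct cliffS as [_ Hcl], (below_refl b) as [x Hx].
destruct (Hcl a (b * x)) as (u & _ & Hu & _).
{ unfold ordered_idempotent; rewrite op_assoc; now apply le_opr. }
exists (x * u); apply le_trans with (a * (b * x) * b).
- rewrite <- op_assoc; now apply le_opl.
- rewrite (op_assoc b x u); now apply le_opr.
Qed.

Lemma clifford_swap_right a b : exists w, a * b <= a * b * w * a.
Proof.
destruct cliffS as [_ Hcl], (below_refl a) as [x Hx].
destruct (Hcl b (x * a)) as (_ & v & _ & Hv).
{ unfold ordered_idempotent; rewrite <- op_assoc; apply le_opl.
  now rewrite op_assoc. }
exists (v * x); apply le_trans with (a * (x * a * b)).
- rewrite !op_assoc; now apply le_opr.
- replace (a * b * (v * x) * a) with (a * (b * v * (x * a)))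
    by now rewrite !op_assoc.
  now apply le_opl.
Qed.

(** Carrying [b] to the left and then [a] to the right exchanges them. *)
Lemma clifford_swap a b : exists w, a * b <= b * w * a.
Proof.
destruct (clifford_swap_left a b) as [u Hu], (clifford_swap_right a b) as [v Hv].
exists (u * (a * b) * v); apply le_trans with (1 := Hu).
replace (b * (u * (a * b) * v) * a) with (b * u * (a * b * v * a))
  by now rewrite !op_assoc.
rewrite <- (op_assoc (b * u)); now apply le_opl.
Qed.

(** Commuting [b] past [s], respectively past [t], puts [a] in both (bS] and (Sb];
    regularity of [a] then joins the two bounds into one in (bSb]. *)
Lemma below_of_middle a b s t : a <= s * b * t -> below a b.
Proof.
intros Ha.
destruct (clifford_swap s b) as [u Hu], (clifford_swap b t) as [v Hv].
destruct (below_refl a) as [z Hz].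
assert (Hl : a <= b * u * s * t).
{ apply le_trans with (1 := Ha); now apply le_opr. }
assert (Hr : a <= s * (t * v * b)).
{ apply le_trans with (1 := Ha); rewrite <- op_assoc; now apply le_opl. }
exists (u * s * t * z * s * t * v); apply le_trans with (1 := Hz).
apply le_trans with (b * u * s * t * z * (s * (t * v * b))).
- apply op_mono; [now apply le_opr | exact Hr].
- rewrite !op_assoc; apply le_refl.
Qed.

(** The missing left factor comes from regularity of [b]. *)
Lemma below_of_left a b t : a <= b * t -> below a b.
Proof.
intros Ha; destruct (below_refl b) as [z Hz].
apply below_of_middle with (b * z) t.
apply le_trans with (1 := Ha); now apply le_opr.
Qed.

Lemma below_of_right a b s : a <= s * b -> below a b.
Proof.
intros Ha; destruct (below_refl b) as [z Hz].
apply below_of_middle with s (z * b).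
apply le_trans with (1 := Ha).
rewrite <- op_assoc; apply le_opl; now rewrite op_assoc.
Qed.

Lemma below_opl a b c : below a b -> below (c * a) (c * b).
Proof.
intros [z Hz]; apply below_of_left with (z * b).
rewrite <- op_assoc; apply le_opl; now rewrite op_assoc.
Qed.

Lemma below_opr a b c : below a b -> below (a * c) (b * c).
Proof.
intros [z Hz]; apply below_of_right with (b * z).
rewrite op_assoc; now apply le_opr.
Qed.

Lemma below_comm a b : below (a * b) (b * a).
Proof.
destruct (clifford_swap a b) as [w Hw], (clifford_swap w a) as [v Hv].
apply below_of_left with (v * w); apply le_trans with (1 := Hw).
replace (b * a * (v * w)) with (b * (a * v * w)) by now rewrite !op_assoc.
rewrite <- op_assoc; now apply le_opl.
Qed.

(** In [a <= a * x * a] the last [a] can be moved next to the first. *)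
Lemma below_square a : below a (a * a).
Proof.
destruct (below_refl a) as [x Hx], (clifford_swap x a) as [w Hw].
apply below_of_left with (w * x); apply le_trans with (1 := Hx).
replace (a * a * (w * x)) with (a * (a * w * x)) by now rewrite !op_assoc.
rewrite <- op_assoc; now apply le_opl.
Qed.

Lemma op_below_left a b : below (a * b) a.
Proof. apply below_of_left with b; apply le_refl. Qed.

Lemma op_below_right a b : below (a * b) b.
Proof. apply below_of_right with a; apply le_refl. Qed.

Definition below_equiv a b : Prop := below a b /\ below b a.

Lemma below_equiv_equivalence : equivalence S below_equiv.
Proof.
split.
- intros a; split; apply below_refl.
- intros a b c [Hab Hba] [Hbc Hcb]; split; eauto using below_trans.
- intros a b [Hab Hba]; now split.
Qed.

(** For completeness, [a <= b] yields [a * a <= a * b], and [a] is below [a * a]. *)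
Lemma below_equiv_complete : complete_semilattice_congruence below_equiv.
Proof.
split; [split; [split | split] |].
- apply below_equiv_equivalence.
- intros a b c [Hab Hba]; split; split; auto using below_opl, below_opr.
- intros a; split; [apply below_square | apply op_below_left].
- intros a b; split; apply below_comm.
- intros a b Hab; split; [| apply op_below_left].
  apply below_trans with (a * a); [apply below_square |].
  apply le_below_trans with (a * b); [now apply le_opl | apply below_refl].
Qed.

Lemma below_equiv_subsemigroup c : subsemigroup (below_equiv c).
Proof.
intros a b [Hca Hac] [Hcb Hbc]; split.
- apply below_trans with (c * c); [apply below_square |].
  apply below_trans with (a * c); [now apply below_opr | now apply below_opl].
- apply below_trans with a; [apply op_below_left | exact Hac].
Qed.

Lemma below_equiv_group_like c :
  group_like (induced (below_equiv_subsemigroup (c:=c))).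
Proof.
intros [a [Hca Hac]] [b [Hcb Hbc]].
assert (Hab : below a b) by now apply below_trans with c.
destruct Hab as [z Hz].
assert (Hx : below_equiv c (b * z)).
{ split.
  - apply below_trans with (1 := Hca); now apply below_of_left with b.
  - apply below_trans with b; [apply op_below_left | exact Hbc]. }
assert (Hy : below_equiv c (z * b)).
{ split.
  - apply below_trans with (1 := Hca).
    apply below_of_right with b; now rewrite op_assoc.
  - apply below_trans with b; [apply op_below_right | exact Hbc]. }
exists (exist _ _ Hx), (exist _ _ Hy); split; [exact Hz |].
change (a <= b * (z * b)); now rewrite op_assoc.
Qed.

End CliffordToSemilattice.

(** Solve [a <= b * y], then solve [y <= x * b]. *)
Lemma group_like_below (T : ordered_semigroup) (a b : T) :
  group_like T -> below a b.
Proof.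
intros HT; destruct (HT a b) as (_ & y & _ & Hy), (HT y b) as (x & _ & Hx & _).
exists x; apply le_trans with (1 := Hy).
rewrite <- op_assoc; now apply le_opl.
Qed.

Lemma class_below (S : ordered_semigroup) (H : S -> Prop) (HH : subsemigroup H)
    (a b : S) : group_like (induced HH) -> H a -> H b -> below a b.
Proof.
intros HT Ha Hb.
destruct (@group_like_below (induced HH) (exist H a Ha) (exist H b Hb) HT)
  as [[z Hz] Hle].
now exists z.
Qed.

Lemma semilattice_of_group_like_clifford (S : ordered_semigroup) :
  complete_semilattice_of S group_like -> clifford S.
Proof.
intros (rho & [[[[Hrefl _ _] _] [_ Hcomm]] _] & Hclass).
assert (Hrho : forall a b, rho a b -> below a b).
{ intros a b Hab; destruct (Hclass a) as [HH HT].
  exact (class_below HT (Hrefl a) Hab). }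
split.
- apply regular_below; intros a; now apply Hrho.
- intros a e _.
  destruct (Hrho _ _ (Hcomm a e)) as [x Hx], (Hrho _ _ (Hcomm e a)) as [y Hy].
  exists (a * x * e), (e * y * a); split.
  + rewrite !op_assoc in *; exact Hx.
  + rewrite !op_assoc in *; exact Hy.
Qed.

Theorem theorem5p6 (S : ordered_semigroup) (no_zero : ~ has_zero S) :
  clifford S <-> complete_semilattice_of S group_like.
Proof.
split.
- intros HS; exists (@below_equiv S); split.
  + now apply below_equiv_complete.
  + intros c; exists (below_equiv_subsemigroup HS (c:=c)).
    apply below_equiv_group_like.
- apply semilattice_of_group_like_clifford.
Qed.
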